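(* Let $L$ be a Lie algebra over a field that is graded by the multiplicative group $(\mathbb{F}^\times,\cdot)$ of a field $\mathbb{F}$, and let $X=\{g\in\mathbb{F}^\times\mid L_g\neq\{0\}\}$ be the support of the grading. If $X$ is arithmetically-free in $(\mathbb{F}^\times,\cdot)$, then $L$ is nilpotent and its nilpotency class $c(L)$ satisfies $$c(L)\;\leq\;\delta(X)^{2^{|X|-1}-1}\;\leq\;|X|^{2^{|X|-1}-1}.$$
   Context: A grading of a Lie algebra $L$ by a group $(G,\cdot)$ is a decomposition $L=\bigoplus_{g\in G}L_g$ into subspaces with $[L_g,L_h]\subseteq L_{g\cdot h}$ for all $g,h\in G$. There are no restrictions on the base field or dimension of $L$. With $L^1=L$ and $L^{n+1}=[L^n,L]$, the class $c(L)$ of a nilpotent Lie algebra $L$ is the smallest $c$ with $L^{c+1}=\{0\}$. For a subset $X$ of an abelian group $(G,+)$ put $P_G(X)=\{g\in G\mid\exists x\in X: x+\langle g\rangle\subseteq X\}$, where $\langle g\rangle$ is the cyclic subgroup generated by $g$. A finite subset $X$ of an abelian group $G$ is arithmetically-free in $G$ iff $X\cap P_G(X)=\emptyset$. (Here this is applied to the abelian group $(\mathbb{F}^\times,\cdot)$, with $\mathbb{F}^\times=\mathbb{F}\setminus\{0\}$ and the group operation written multiplicatively.) For a non-empty arithmetically-free subset $X$ of an abelian group $(G,+)$, $\delta(X)$ is the minimal $\delta\in\{1,\ldots,|X|\}$ such that for all $a,b_1,\ldots,b_\delta\in X$ there is $I\subseteq\{1,\ldots,\delta\}$ with $a+\sum_{i\in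 I}b_i\in G\setminus X$ (such a $\delta$ always exists). The bound is read for non-empty $X$, that is, for $L\neq\{0\}$. *)

(* Defs.v *)
From HB Require Import structures.
From mathcomp Require Export all_boot all_order all_algebra finmap.
From mathcomp Require Export boolp classical_sets functions cardinality.

Set Implicit Arguments.
Unset Strict Implicit.
Unset Printing Implicit Defensive.

Import GRing.Theory.

Local Open Scope classical_set_scope.
Local Open Scope ring_scope.

HB.mixin Record isLieAlgebra (K : fieldType) L of GRing.Lmodule K L := {
  lie : L -> L -> L;
  lie_linearl : forall y : L, linear (fun x => lie x y);
  lie_linearr : forall x : L, linear (fun y => lie x y);
  lie_alternating : forall x : L, lie x x = 0;
  lie_jacobi : forall x y z : L,
    lie x (lie y z) + lie y (lie z x) + lie z (lie x y) = 0
}.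

#[short(type="lieAlgType")]
HB.structure Definition LieAlgebra (K : fieldType) :=
  { L of GRing.Lmodule K L & isLieAlgebra K L }.

Definition least (P : set nat) : nat :=
  xget 0%N [set n | P n /\ forall m, P m -> (n <= m)%N].

Lemma leastP (P : set nat) : P !=set0 ->
  P (least P) /\ forall m, P m -> (least P <= m)%N.
Proof.
move=> [n Pn]; have exP : exists n, `[< P n >] by exists n; apply/asboolP.
apply: (@xgetPex _ 0%N [set n | P n /\ forall m, P m -> (n <= m)%N]).
case: (ex_minnP exP) => m /asboolP Pm minm; exists m; split=> // k Pk.
by apply: minm; apply/asboolP.
Qed.

Section LieAlgebraTheory.
Variables (K : fieldType) (L : lieAlgType K).
Implicit Types M N : set L.

Definition subspace M := GRing.submod_closed [in M].

Definition lie_prod M N : set L :=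
  smallest subspace [set lie x y | x in M & y in N].

(* Indexed as L^1 = L and L^(n+1) = [L^n, L]; the value at n = 0 is unused. *)
Definition lower_central (n : nat) : set L :=
  iter n.-1 (fun M => lie_prod M setT) setT.

Definition nilpotent := exists c, lower_central c.+1 = [set 0].

Definition nilpotency_class : nat :=
  least [set c | lower_central c.+1 = [set 0]].

Record is_grading (G : groupType) (gr : G -> set L) : Prop := IsGrading {
  grading_subspace : forall g, subspace (gr g);
  grading_span : forall x : L, exists (s : {fset G}) (u : G -> L),
    (forall g, gr g (u g)) /\ x = \sum_(g <- s) u g;
  grading_direct : forall (s : {fset G}) (u : G -> L),
    (forall g, gr g (u g)) -> \sum_(g <- s) u g = 0 ->
    forall g, g \in s -> u g = 0;
  grading_lie : forall g h x y,
    gr g x -> gr h y -> gr (g * h)%g (lie x y)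
}.

Definition grading_support (G : groupType) (gr : G -> set L) : set G :=
  [set g | gr g <> [set 0]].

End LieAlgebraTheory.

Arguments nilpotent {K} L.
Arguments nilpotency_class {K} L.

(* The arithmetic notions are meant for abelian groups; they are written
   multiplicatively because they are applied to the group F^x. *)
Section ArithmeticallyFree.
Variable G : groupType.
Implicit Types X : set G.

Definition cyclic_subgroup (g : G) : set G :=
  range (fun n : nat => (g ^+ n)%g) `|` range (fun n : nat => (g ^- n)%g).

Definition periods X : set G :=
  [set g | exists2 x, X x & [set (x * h)%g | h in cyclic_subgroup g] `<=` X].

Definition arithmetically_free X := finite_set X /\ X `&` periods X = set0.

Definition set_card X : nat := #|` fset_set X|.

Definition escapes X (d : nat) := forall (a : G) (b : 'I_d -> G),
  X a -> (forall i, X (b i)) ->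
  exists I : {set 'I_d}, ~ X (a * \prod_(i in I) b i)%g.

Definition delta X : nat :=
  least [set d | (1 <= d <= set_card X)%N /\ escapes X d].

Local Definition subset_prod d (a : G) (b : 'I_d -> G) (I : {set 'I_d}) : G :=
  (a * \prod_(i in I) b i)%g.

Local Lemma fset_mulV (S : {fset G}) (c : G) :
  (forall x, x \in S -> (x * c)%g \in S) ->
  forall x, x \in S -> (x * c^-1)%g \in S.
Proof.
move=> Sc x; have: [fset (x * c)%g | x in S]%fset = S.
  apply/eqP; rewrite eqEfcard card_imfset /=; last by move=> y z; exact: mulIg.
  by rewrite leqnn andbT; apply/fsubsetP => _ /imfsetP[y Sy ->]; exact: Sc.
by move=> {1}<- /imfsetP[y Sy ->]; rewrite mulgK.
Qed.

(* The minimum defining delta is attained, so delta never takes the default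
   value of least on non-empty arithmetically-free sets. *)
Local Lemma subset_products X (a : G) d (b : 'I_d -> G) :
  arithmetically_free X -> (forall i, X (b i)) ->
  (forall I : {set 'I_d}, X (a * \prod_(i in I) b i)%g) ->
  (d < #|` [fset subset_prod a b I | I in {: {set 'I_d}}]%fset|)%N.
Proof.
move=> [Xfin XP]; elim: d b => [|d IHd] b Xb XS.
  by rewrite cardfs_gt0; apply/fset0Pn; eexists; apply/imfsetP; exists finset.set0.
pose b' i := b (widen_ord (leqnSn d) i).
have recr (I : {set 'I_d.+1}) : (\prod_(i in I) b i =
  \prod_(i in [set i : 'I_d | widen_ord (leqnSn d) i \in I]%SET) b' i *
  (if ord_max \in I then b ord_max else 1))%g.
  rewrite [LHS]big_mkcond [X in (X * _)%g]big_mkcond big_ord_recr /=.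
  by congr (_ * _)%g; apply: eq_bigr => i _; rewrite inE.
pose lft (J : {set 'I_d}) (e : bool) : {set 'I_d.+1} :=
  [set i | if unlift ord_max i is Some j then j \in J else e]%SET.
have lftE J e : (\prod_(i in lft J e) b i =
    (\prod_(i in J) b' i) * (if e then b ord_max else 1))%g.
  rewrite recr inE unlift_none; congr (_ * _)%g; apply: eq_bigl => i.
  rewrite !inE; have -> : widen_ord (leqnSn d) i = lift ord_max i.
    by apply/val_inj; rewrite /= /bump leqNgt ltn_ord.
  by rewrite liftK.
set S' := [fset subset_prod a b I | I in {: {set 'I_d.+1}}]%fset.
have {}IHd : (d < #|` [fset subset_prod a b' I | I in {: {set 'I_d}}]%fset|)%N.
  apply: IHd => [i|I]; first exact: Xb.
  by have := XS (lft I false); rewrite lftE mulg1.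
set S := [fset subset_prod a b' I | I in {: {set 'I_d}}]%fset in IHd.
have sSS' : (S `<=` S')%fset.
  apply/fsubsetP => _ /imfsetP[I _ ->]; apply/imfsetP; exists (lft I false) => //.
  by rewrite /subset_prod lftE mulg1.
have sX x : x \in S' -> X x by move=> /imfsetP[I _ ->]; exact: XS.
rewrite ltnNge; apply/negP => leS'.
have eqS : S = S'.
  by apply/eqP; rewrite eqEfcard sSS' (leq_trans leS').
pose c := b ord_max.
have Sc x : x \in S -> (x * c)%g \in S.
  move=> /imfsetP[I _ ->]; rewrite eqS; apply/imfsetP; exists (lft I true) => //.
  by rewrite /subset_prod lftE mulgA.
have ScV := fset_mulV Sc.
have Xc : X c by exact: Xb.
have: (X `&` periods X) c; last by rewrite XP.
split=> //; have [x Sx] : exists x, x \in S.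
  by apply/fset0Pn; rewrite -cardfs_gt0; exact: leq_ltn_trans IHd.
exists x; first by apply: sX; rewrite -eqS.
move=> _ [_ [[n _ <-]|[n _ <-]] <-]; apply: sX; rewrite -eqS.
  by elim: n => [|n IHn]; rewrite ?mulg1 // expgSr mulgA; exact: Sc.
rewrite -expVgn; elim: n => [|n IHn]; rewrite ?mulg1 // expgSr mulgA.
exact: ScV.
Qed.

Lemma escapes_card X : arithmetically_free X -> escapes X (set_card X).
Proof.
move=> afX a b Xa Xb; apply: contrapT => /forallNP XS.
have {}XS (I : {set 'I_(set_card X)}) : X (a * \prod_(i in I) b i)%g.
  by apply: contrapT; exact: XS.
have := subset_products afX Xb XS; apply/negP; rewrite -leqNgt.
apply: fsubset_leq_card; apply/fsubsetP => _ /imfsetP[I _ ->].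
by rewrite in_fset_set ?inE; [exact: XS | case: afX].
Qed.

Lemma deltaP X : arithmetically_free X -> X !=set0 ->
  [/\ (1 <= delta X <= set_card X)%N, escapes X (delta X) &
      forall d, (1 <= d <= set_card X)%N -> escapes X d -> (delta X <= d)%N].
Proof.
move=> afX [x Xx]; have [|[? ?] min] :=
    @leastP [set d | (1 <= d <= set_card X)%N /\ escapes X d]; last first.
  by split=> // d dX ed; apply: min.
exists (set_card X); split; last exact: escapes_card.
rewrite leqnn andbT /set_card cardfs_gt0; apply/fset0Pn; exists x.
by rewrite in_fset_set ?inE //; case: afX.
Qed.

End ArithmeticallyFree.

Definition nonzero (F : fieldType) := {x : F | x != 0}.

Section MultiplicativeGroup.
Variable F : fieldType.
Implicit Types x y z : nonzero F.

HB.instance Definition _ := Choice.on (nonzero F).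

Definition nonzero_one : nonzero F := Sub 1 (oner_neq0 F).

Definition nonzero_inv x : nonzero F :=
  Sub (val x)^-1 (invr_neq0 (valP x)).

Definition nonzero_mul x y : nonzero F :=
  Sub (val x * val y) (mulf_neq0 (valP x) (valP y)).

Local Lemma nonzero_mulA : associative nonzero_mul.
Proof. by move=> x y z; apply: val_inj; rewrite /= mulrA. Qed.

Local Lemma nonzero_mul1x : left_id nonzero_one nonzero_mul.
Proof. by move=> x; apply: val_inj; rewrite /= mul1r. Qed.

Local Lemma nonzero_mulx1 : right_id nonzero_one nonzero_mul.
Proof. by move=> x; apply: val_inj; rewrite /= mulr1. Qed.

Local Lemma nonzero_mulVx : left_inverse nonzero_one nonzero_inv nonzero_mul.
Proof. by move=> x; apply: val_inj; rewrite /= mulVf // (valP x). Qed.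

Local Lemma nonzero_mulxV : right_inverse nonzero_one nonzero_inv nonzero_mul.
Proof. by move=> x; apply: val_inj; rewrite /= mulfV // (valP x). Qed.

HB.instance Definition _ := isGroup.Build (nonzero F)
  nonzero_mulA nonzero_mul1x nonzero_mulx1 nonzero_mulVx nonzero_mulxV.

End MultiplicativeGroup.

(* Main.v *)
(* Kreknin's method.  As finite subgroups of [F^x] are cyclic, some homomorphism
   from the group generated by [X] to a finite cyclic group [Z/N] does not
   vanish on [X]; reading its values as integers in [0, N) orders [X] so that in
   [g * h = k] both factors lie above [k] or both lie below.  Eliminating the
   components of [L] one at a time in this order puts [D = L^(2^(|X|-1)-1)]
   inside the subalgebra generated by the last component, and, reversing the
   order, inside the one generated by the first component; both together force
   [D] to be central.  Finally, modulo brackets with [L^(i+1)] the elements of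
   [L^(i)] act on [L] by commuting operators, so the definition of [delta] turns
   [delta] factors from [L^(i)] into one factor from [L^(i+1)], and hence
   [delta ^ (2^(|X|-1)-1)] factors from [L] into a factor from [D]. *)

Require Import Defs.
From mathcomp Require Import ring zify.

Set Implicit Arguments.
Unset Strict Implicit.
Unset Printing Implicit Defensive.

Import Order.TTheory GRing.Theory Num.Theory.

Local Open Scope classical_set_scope.
Local Open Scope nat_scope.

(** Integer representatives of a homomorphism to [Z/N] that does not vanish on [X]; the two
    alternatives are addition without and with a carry. *)
Definition cyclic_weight (G : groupType) (X : set G) (N : nat)
    (theta : G -> nat) : Prop :=
  (forall g, X g -> 0 < theta g < N) /\
  (forall g h, X g -> X h -> X (g * h)%g ->
     theta (g * h)%g = theta g + theta h \/
     theta (g * h)%g + N = theta g + theta h).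

(** * Cyclic characters of finitely generated subgroups of [F^x] *)

Section FiniteCharacters.
Local Open Scope ring_scope.
Variable F : fieldType.
Implicit Types (A B : set F) (x y z : F).

Record mul_subgroup A : Prop := MulSubgroup {
  mul_subgroup_neq0 : forall x, A x -> x != 0;
  mul_subgroup1 : A 1;
  mul_subgroupM : forall x y, A x -> A y -> A (x * y);
  mul_subgroupV : forall x, A x -> A x^-1 }.

(** A homomorphism to [Z/N] given by integer lifts of its values, so that passing to the modulus
    [N * M] is multiplication by [M]. *)
Definition character_mod A (N : int) (chi : F -> int) : Prop :=
  0 < N /\ forall x y, A x -> A y -> (N %| chi (x * y) - (chi x + chi y))%Z.

(** One character must be nonzero on all of [Y] at once. This fails for the three involutions of the
    Klein four-group, so the field structure has to enter. *)
Definition has_characters A : Prop := forall Y : seq F,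
  (forall y, y \in Y -> A y /\ y != 1) ->
  exists N chi, character_mod A N chi /\
    forall y, y \in Y -> ~~ (N %| chi y)%Z.

Definition adjoin A x : set F :=
  [set z | exists2 a, A a & exists j : int, z = a * x ^ j].

Lemma mul_subgroupX A x (j : int) : mul_subgroup A -> A x -> A (x ^ j).
Proof.
move=> [_ A1 AM AV] Ax.
have AX (n : nat) : A (x ^+ n).
  by elim: n => [|n IHn]; rewrite ?expr0 // exprS; exact: AM.
by case: j => n; [exact: AX | exact/AV/AX].
Qed.

Lemma sub_adjoin A x : A `<=` adjoin A x.
Proof. by move=> a Aa; exists a => //; exists 0; rewrite expr0z mulr1. Qed.

Lemma adjoin_gen A x : mul_subgroup A -> adjoin A x x.
Proof. by move=> sA; exists 1; [case: sA | exists 1; rewrite mul1r expr1z]. Qed.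

Lemma adjoin_subset A B x : mul_subgroup B -> A `<=` B -> B x ->
  adjoin A x `<=` B.
Proof.
move=> sB AB Bx _ [a /AB Ba [j ->]].
by apply: mul_subgroupM => //; exact: mul_subgroupX.
Qed.

Lemma mul_subgroup_adjoin A x : mul_subgroup A -> x != 0 ->
  mul_subgroup (adjoin A x).
Proof.
move=> sA x0; split.
- by move=> _ [a /(mul_subgroup_neq0 sA) a0 [j ->]]; rewrite mulf_neq0 ?expfz_neq0.
- exact: sub_adjoin (mul_subgroup1 sA).
- move=> _ _ [a Aa [j ->]] [b Ab [i ->]].
  exists (a * b); first exact: mul_subgroupM.
  by exists (j + i); rewrite expfzDr //; ring.
- move=> _ [a Aa [j ->]]; exists a^-1; first exact: mul_subgroupV.
  by exists (- j); rewrite -invr_expz invfM.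
Qed.

Lemma has_characters_subset A B : A `<=` B -> has_characters B ->
  has_characters A.
Proof.
move=> AB cB Y YA; have [y /YA[/AB]//|N [chi [[N0 chiM] chiY]]] := cB Y.
by exists N, chi; split=> //; split=> // x y /AB Bx /AB By; exact: chiM.
Qed.

Lemma character_mod1 A N chi : mul_subgroup A -> character_mod A N chi ->
  (N %| chi 1%R)%Z.
Proof.
move=> [_ A1 _ _] [_ /(_ _ _ A1 A1)]; rewrite mul1r.
by rewrite opprD addrA subrr sub0r rpredN.
Qed.

Lemma character_modX A N chi x (j : int) : mul_subgroup A ->
  character_mod A N chi -> A x -> (N %| chi (x ^ j) - j * chi x)%Z.
Proof.
move=> sA chiA Ax; have chi1 := character_mod1 sA chiA.
have [_ chiM] := chiA.
have Xn (n : nat) : (N %| chi (x ^+ n) - n%:Z * chi x)%Z.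
  elim: n => [|n IHn]; first by rewrite expr0 mul0r subr0.
  rewrite exprS; have := chiM _ _ Ax (mul_subgroupX n sA Ax).
  move=> /(rpredD IHn); congr (_ %| _)%Z; rewrite -[n.+1]addn1 PoszD.
  by rewrite -[x ^ n]/(x ^+ n); ring.
case: j => n; first exact: Xn.
have Axn := mul_subgroupX n.+1 sA Ax.
rewrite -[x ^ _]/((x ^+ n.+1)^-1) NegzE.
have := chiM _ _ Axn (mul_subgroupV sA Axn).
rewrite -[x ^ _]/(x ^+ n.+1) mulfV ?expf_neq0 ?(mul_subgroup_neq0 sA) //.
move=> /(rpredB chi1) h; have := rpredB h (Xn n.+1).
by congr (_ %| _)%Z; ring.
Qed.

(** The extension is [M * chi] on [A] and [c] at [x]; the last hypothesis says that it respects
    every relation [a * x ^ j = 1], which makes it well defined modulo [N * M]. *)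
Lemma character_mod_extend A N chi x (M c : int) :
  mul_subgroup A -> character_mod A N chi -> x != 0 -> 0 < M ->
  (forall a (j : int), A a -> a * x ^ j = 1 ->
    (N * M %| M * chi a + j * c)%Z) ->
  exists chi', character_mod (adjoin A x) (N * M) chi' /\
    forall a (j : int), A a ->
      (N * M %| chi' (a * x ^ j) - (M * chi a + j * c))%Z.
Proof.
move=> sA chiA x0 M0 hc; have [N0 chiM] := chiA.
pose dec z := [set p : F * int | A p.1 /\ z = p.1 * x ^ p.2].
pose d z := xget (0, 0) (dec z).
pose chi' z := M * chi (d z).1 + (d z).2 * c.
have chi'E a (j : int) : A a ->
    (N * M %| chi' (a * x ^ j) - (M * chi a + j * c))%Z.
  move=> Aa; rewrite /chi'; set z := a * x ^ j.
  have : dec z (d z) by apply: (@xgetPex _ _ (dec z)); exists (a, j).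
  case: (d z) => b i [/= Ab zE].
  have Aab : A (b / a) by apply: mul_subgroupM => //; exact: mul_subgroupV.
  have a0 := mul_subgroup_neq0 sA Aa.
  (* Two decompositions of [z] differ by a relation. *)
  have /(hc _ _ Aab) : b / a * x ^ (i - j) = 1.
    by rewrite expfzDr // -invr_expz mulrACA -zE -invfM mulfV // mulf_neq0 ?expfz_neq0.
  have /(dvdz_mul (dvdzz M)) := chiM _ _ Aab Aa.
  rewrite divfK // [M * N]mulrC => h1 h2; move: (rpredD h1 h2).
  by congr (_ %| _)%Z; ring.
exists chi'; split=> //; split; first exact: mulr_gt0.
move=> _ _ [a Aa [j ->]] [b Ab [i ->]].
have -> : a * x ^ j * (b * x ^ i) = a * b * x ^ (j + i).
  by rewrite expfzDr //; ring.
have hab := chi'E _ (j + i) (mul_subgroupM sA Aa Ab).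
have ha := chi'E _ j Aa; have hb := chi'E _ i Ab.
have /(dvdz_mul (dvdzz M)) := chiM _ _ Aa Ab; rewrite [M * N]mulrC => h.
move: (rpredB (rpredB (rpredD hab h) ha) hb).
by congr (_ %| _)%Z; ring.
Qed.

(** The value at [x] is free; it is 1, with [M] above all exponents of [x] in [Y]. If
    [M * chi a + j] vanishes modulo [N * M], then [M] divides [j], so [j = 0] and [chi a] vanishes
    modulo [N]. *)
Lemma has_characters_adjoin_free A x : mul_subgroup A -> has_characters A ->
  x != 0 -> (forall j : int, A (x ^ j) -> j = 0) ->
  has_characters (adjoin A x).
Proof.
move=> sA cA x0 xfree Y YA.
have [y|N [chi [chiA chiY]]] := cA [seq y <- Y | `[< A y >]].
  by rewrite mem_filter => /andP[/asboolP Ay /YA[_]].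
have [M M0 YM] : exists2 M : int, 0 < M & forall y, y \in Y ->
    exists2 a, A a & exists2 j : int, y = a * x ^ j & `|j| < M.
  elim: Y YA {chiY} => [|y Y IHY] YA; first by exists 1.
  have [|M M0 YM] := IHY; first by move=> z zY; apply: YA; rewrite inE zY orbT.
  have [[a Aa [j yE]] _] := YA y (mem_head y Y).
  exists (M + `|j|); first by lia.
  move=> z; rewrite inE => /predU1P[->|/YM[b Ab [i zE iM]]].
    by exists a => //; exists j => //; lia.
  by exists b => //; exists i => //; lia.
have N0 : 0 < N by case: chiA.
have [] := @character_mod_extend A N chi x M 1 sA chiA x0 M0.
  move=> a j Aa axj; have j0 : j = 0.
    apply: xfree; have -> : x ^ j = a^-1.
      have a0 := mul_subgroup_neq0 sA Aa.
      by apply: (mulfI a0); rewrite axj mulfV.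
    exact: mul_subgroupV.
  have -> : a = 1 by rewrite -axj j0 expr0z mulr1.
  by rewrite j0 mul0r addr0 mulrC dvdz_mul // (character_mod1 sA chiA).
move=> chi' [chi'A chi'E]; exists (N * M), chi'; split=> // y yY.
apply/negP; have [a Aa [j yE jM]] := YM y yY.
have := chi'E a j Aa; rewrite -yE mulr1 => h1 h2.
have := rpredB h2 h1; rewrite opprB addrC subrK => h3.
have j0 : j = 0.
  have /dvdzP[q hq] := h3.
  have : (M %| j)%Z.
    apply/dvdzP; exists (q * N - chi a).
    by rewrite mulrBl -mulrA -hq; ring.
  move=> /dvdzP[r rE]; move: jM; rewrite rE => jM.
  suff -> : r = 0 by rewrite mul0r.
  by nia.
move: yE h3; rewrite j0 expr0z mulr1 addr0 => ya.
rewrite [N * M]mulrC dvdz_mul2l; last by lia.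
rewrite -ya; apply/negP/chiY; rewrite mem_filter yY andbT.
by apply/asboolP; rewrite ya.
Qed.

(** In [p * chi] the value at [x ^+ p] is divisible by [p], so [x] can be given a value. If
    [y ^+ p != 1], then [y] is detected through its [p]-th power; otherwise [y] lies in [A] or is a
    power of the primitive root [x]. *)
Lemma has_characters_adjoin_prime A x (p : nat) : mul_subgroup A ->
  has_characters A -> x != 0 -> ~ A x -> prime p -> A (x ^+ p) ->
  has_characters (adjoin A x).
Proof.
move=> sA cA; have A1 := mul_subgroup1 sA.
(* If some [y] in [A<x>] outside [A] satisfies [y ^ p = 1], then [A<x> = A<y>],
   and all [p]-th roots of unity are powers of [y], as [F] has at most [p]. *)
wlog hx : x / x ^+ p = 1 \/ forall z, adjoin A x z -> z ^+ p = 1 -> A z.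
  move=> IH x0 nAx pp Axp.
  have [[y [xy yp nAy]]|nex] :=
      pselect (exists y, [/\ adjoin A x y, y ^+ p = 1 & ~ A y]); last first.
    apply: (IH x) => //; right=> z xz zp; apply: contrapT => nAz.
    by apply: nex; exists z.
  have y0 : y != 0 := mul_subgroup_neq0 (mul_subgroup_adjoin sA x0) xy.
  apply: (@has_characters_subset _ (adjoin A y)); last first.
    by apply: IH => //; [left | rewrite yp].
  have sAy := mul_subgroup_adjoin sA y0.
  apply: adjoin_subset => //; first exact: sub_adjoin.
  case: xy => a Aa [j yE].
  have cop : coprimez j p.
    rewrite coprimez_sym coprimezE /= prime_coprime //; apply/negP => pj.
    have /dvdzP[q jE] : (p %| j)%Z by [].
    apply: nAy; rewrite yE jE [q * _]mulrC -exprz_exp; apply: mul_subgroupM => //.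
    exact: mul_subgroupX.
  have /coprimezP[[u v] /= uv] := cop.
  have -> : x = (y / a) ^ u * (x ^+ p) ^ v.
    have a0 := mul_subgroup_neq0 sA Aa.
    have -> : y / a = x ^ j by rewrite yE mulrC mulKf.
    by rewrite -[x ^+ p]/(x ^ p) !exprz_exp -expfzDr // [j * u]mulrC [_ * v]mulrC uv.
  apply: mul_subgroupM => //; last by apply: mul_subgroupX => //; exact: sub_adjoin.
  apply: mul_subgroupX => //; apply: mul_subgroupM => //; first exact: adjoin_gen.
  by apply: sub_adjoin; exact: mul_subgroupV.
move=> x0 nAx pp Axp Y YA.
have p0 : (p : int) != 0 by case: p pp {hx Axp}.
have xA (j : int) : A (x ^ j) -> (p %| j)%Z.
  move=> Axj; apply/negPn/negP => npj; apply: nAx.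
  have /coprimezP[[u v] /= uv] : coprimez j p.
    by rewrite coprimez_sym coprimezE /= prime_coprime.
  have -> : x = (x ^ j) ^ u * (x ^+ p) ^ v.
    by rewrite -[x ^+ p]/(x ^ p) !exprz_exp -expfzDr // [j * u]mulrC [_ * v]mulrC uv.
  by apply: mul_subgroupM => //; exact: mul_subgroupX.
pose Y' := [seq y <- Y ++ [seq y ^+ p | y <- Y] | `[< A y >] & y != 1].
have [y|N [chi [chiA chiY]]] := cA Y'.
  by rewrite mem_filter => /andP[/andP[/asboolP]].
have [N0 chiM] := chiA; have chi1 := character_mod1 sA chiA.
have {}chiY y : y \in Y ++ [seq y ^+ p | y <- Y] -> A y -> y != 1 ->
    ~~ (N %| chi y)%Z.
  by move=> yY Ay y1; apply: chiY; rewrite mem_filter yY y1 !andbT; apply/asboolP.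
(* If [x ^+ p = 1], the value must be a multiple of [N] that is nonzero modulo [N * p]. *)
pose c := if x ^+ p == 1 then N else chi (x ^+ p).
have cE : (N %| c - chi (x ^+ p))%Z.
  rewrite /c; case: ifP => [/eqP ->|_]; last by rewrite subrr dvdz0.
  by rewrite rpredB.
have [] := @character_mod_extend A N chi x p c sA chiA x0.
- by case: p pp {hx Axp p0 xA Y' chiY c cE}.
- move=> a j Aa axj.
  have aE : a = x ^ (- j) by rewrite -invr_expz -[a](mulfK (expfz_neq0 j x0)) axj mul1r.
  have /dvdzP[q jE] : (p %| - j)%Z by apply: xA; rewrite -aE.
  have {jE}jE : j = - q * p by rewrite mulNr -jE opprK.
  have := character_modX q sA chiA Axp.
  have -> : (x ^+ p) ^ q = a by rewrite aE jE mulNr opprK mulrC -exprz_exp.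
  move=> h; rewrite jE mulNr.
  have -> : p%:Z * chi a + - (q * p) * c = p%:Z * (chi a - q * c) by ring.
  rewrite [N * _]mulrC dvdz_mul2l //.
  have := rpredB h (dvdz_mull q cE).
  by congr (_ %| _)%Z; ring.
move=> chi' [chi'A chi'E]; exists (N * p), chi'; split=> // y yY.
apply/negP => hy; have [xy y1] := YA y yY.
have sAx := mul_subgroup_adjoin sA x0.
have in_A z : A z -> (N * p %| chi' z)%Z -> (N %| chi z)%Z.
  move=> Az hz; have := chi'E z 0 Az; rewrite expr0z mulr1 mul0r addr0 => h.
  have := rpredB hz h; rewrite opprB addrC subrK.
  by rewrite [N * _]mulrC dvdz_mul2l.
have hyp : (N * p %| chi' (y ^+ p))%Z.
  have := character_modX p sAx chi'A xy => h.
  by have := rpredD h (dvdz_mull p hy); rewrite subrK.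
have Ayp : A (y ^+ p).
  case: xy => a Aa [j ->]; rewrite exprMn; apply: mul_subgroupM => //.
    exact: (mul_subgroupX p).
  by rewrite -[_ ^+ p]/((x ^ j) ^ p) exprz_exp mulrC -exprz_exp; exact: mul_subgroupX.
have [yp|yp] := eqVneq (y ^+ p) 1; last first.
  apply: (negP (chiY (y ^+ p) _ Ayp yp)); last exact: in_A.
  by rewrite mem_cat (map_f (fun z => z ^+ p)) ?orbT.
case: (hx) => [xp|/(_ _ xy yp) Ay]; last first.
  apply: (negP (chiY y _ Ay y1)); last exact: in_A.
  by rewrite mem_cat yY.
have [m mx mp] := prim_order_exists (prime_gt0 pp) xp.
have {mx mp}px : p.-primitive_root x.
  case/primeP: pp => _ /(_ m mp) /orP[] /eqP mE; move: mx; rewrite mE //.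
  move=> /prim_expr_order.
  by rewrite expr1 => x1; case: nAx; rewrite x1.
have [i yE] := prim_rootP px yp.
have := chi'E 1 i A1; rewrite mul1r -[x ^ i]/(x ^+ i) -yE => h.
have := rpredB hy h; rewrite opprB addrC subrK /c xp eqxx.
have := dvdz_mul (dvdzz p) chi1; rewrite [N * _]mulrC => h1 /rpredB /(_ h1).
rewrite [_ + _ * N]addrC addrK dvdz_mul2r ?gt_eqF // => pi.
have /dvdnP[q iE] : (p %| i)%N by [].
by move: y1; rewrite yE iE mulnC exprM xp expr1n eqxx.
Qed.

(** If [x ^+ m] lies in [A], induction on [m]: for a prime [p] dividing [m], first adjoin [x ^+ p],
    whose exponent is [m / p], and then [x]. *)
Lemma has_characters_adjoin A x : mul_subgroup A -> has_characters A ->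
  x != 0 -> has_characters (adjoin A x).
Proof.
move=> sA cA x0.
have [[m m0 Axm]|xfree] := pselect (exists2 m : nat, (0 < m)%N & A (x ^+ m)); last first.
  apply: has_characters_adjoin_free => // j Axj.
  case: j Axj => [[//|m] Axm|m Axm]; case: xfree; exists m.+1 => //.
  by rewrite -[x ^+ _]invrK; exact: mul_subgroupV.
elim/ltn_ind: m x x0 m0 Axm => m IHm x x0 m0 Axm.
have [m1|m1] := leqP m 1.
  have Ax : A x by move: Axm; have -> : m = 1%N by lia.
  by apply: has_characters_subset cA; exact: adjoin_subset.
have [p pp /dvdnP[q mE]] : exists2 p, prime p & (p %| m)%N.
  by exists (pdiv m); [exact: pdiv_prime | exact: pdiv_dvd].
have q0 : (0 < q)%N by move: m0; rewrite mE muln_gt0 => /andP[].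
have xp0 : x ^+ p != 0 by rewrite expf_neq0.
have cB : has_characters (adjoin A (x ^+ p)).
  apply: (IHm q) => //; first by rewrite mE ltn_Pmulr ?prime_gt1.
  by rewrite -exprM mulnC -mE.
have sB := mul_subgroup_adjoin sA xp0.
have Bxp : adjoin A (x ^+ p) (x ^+ p) by exact: adjoin_gen.
have sub : adjoin A x `<=` adjoin (adjoin A (x ^+ p)) x.
  apply: adjoin_subset; first exact: mul_subgroup_adjoin.
    by move=> a Aa; do 2 apply: sub_adjoin.
  exact: adjoin_gen.
apply: has_characters_subset sub _.
have [Bx|nBx] := pselect (adjoin A (x ^+ p) x).
  by apply: has_characters_subset cB; exact: adjoin_subset.
exact: has_characters_adjoin_prime Bxp.
Qed.

Lemma has_characters_finite (s : seq F) : (forall x, x \in s -> x != 0) ->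
  exists A, [/\ mul_subgroup A, has_characters A & forall x, x \in s -> A x].
Proof.
elim: s => [|x s IHs] s0.
  exists [set 1]; split=> //.
    split=> [_ ->|//|_ _ -> ->|_ ->]; rewrite ?oner_neq0 ?mulr1 ?invr1 //.
  move=> Y Y1; exists 1, (fun=> 0); split; first by split.
  by move=> y /Y1[->]; rewrite eqxx.
have [|A [sA cA As]] := IHs; first by move=> y ys; apply: s0; rewrite inE ys orbT.
have x0 : x != 0 by apply: s0; rewrite inE eqxx.
exists (adjoin A x); split.
- exact: mul_subgroup_adjoin.
- exact: has_characters_adjoin.
- move=> y; rewrite inE => /predU1P[->|/As Ay]; first exact: adjoin_gen.
  exact: sub_adjoin.
Qed.

End FiniteCharacters.

Lemma cyclic_weight_exists (F : fieldType) (X : set (nonzero F)) :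
  finite_set X -> ~ X 1%g -> exists N theta, cyclic_weight X N theta.
Proof.
move=> Xfin X1; pose s := fset_set X.
have sX g : X g -> g \in s by move=> Xg; rewrite in_fset_set // inE.
have [|A [sA cA As]] := @has_characters_finite F [seq val g | g <- s].
  by move=> _ /mapP[[y y0] _ ->].
have XA g : X g -> A (val g) by move=> /sX gs; apply: As; exact: map_f.
have [|N [chi [[N0 chiM] chiX]]] := cA [seq val g | g <- s].
  move=> _ /mapP[g gs ->]; have Xg : X g by move: gs; rewrite in_fset_set // inE.
  split; first exact: XA.
  apply/negP => /eqP g1; apply: X1; rewrite (_ : 1%g = g :> nonzero F) //.
  by apply: val_inj; rewrite g1.
exists `|N|%N, (fun g => `|(chi (val g) %% N)%Z|%N).
have N0' : (N != 0)%R by rewrite gt_eqF.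
have bnd (g : nonzero F) : (0 <= (chi (val g) %% N)%Z < N)%R.
  by rewrite modz_ge0 // ltz_pmod.
split=> [g Xg|g h Xg Xh _].
  have := chiX (val g) (map_f _ (sX _ Xg)); rewrite (sameP dvdz_mod0P eqP).
  have := bnd g; lia.
have /dvdzP[q] := chiM _ _ (XA _ Xg) (XA _ Xh).
have -> : (val g * val h)%R = val (g * h)%g by [].
have := bnd g; have := bnd h; have := bnd (g * h)%g.
have := divz_eq (chi (val g)) N; have := divz_eq (chi (val h)) N.
have := divz_eq (chi (val (g * h)%g)) N.
move: (chi _) (chi _) (chi _) => a b c.
move: (a %% N)%Z (b %% N)%Z (c %% N)%Z (a %/ N)%Z (b %/ N)%Z (c %/ N)%Z.
move=> ra rb rc qa qb qc -> -> -> ha hb hc hq.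
have eqk : (ra + rb - rc = (qc - qa - qb - q) * N)%R.
  by rewrite !mulrBl; lia.
move: (_ - q)%R eqk => k eqk.
(* The multiple [ra + rb - rc] of [N] lies strictly between [-N] and [2 * N]. *)
have [k0|k1] : k = 0%R \/ k = 1%R by nia.
- by left; move: eqk; rewrite k0 mul0r; lia.
- by right; move: eqk; rewrite k1 mul1r; lia.
Qed.

(** * Identities of the Lie bracket *)

Section LieBracket.
Local Open Scope ring_scope.
Variables (K : fieldType) (L : lieAlgType K).
Implicit Types (x y z : L) (c : K).

Lemma liePl c x y z : lie (c *: x + y) z = c *: lie x z + lie y z.
Proof. exact: lie_linearl. Qed.

Lemma liePr c x y z : lie z (c *: x + y) = c *: lie z x + lie z y.
Proof. exact: lie_linearr. Qed.

Lemma lie0l x : lie 0 x = 0 :> L.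
Proof. by have := liePl (-1) 0 0 x; rewrite scaler0 addr0 scaleN1r addNr. Qed.

Lemma lie0r x : lie x 0 = 0 :> L.
Proof. by have := liePr (-1) 0 0 x; rewrite scaler0 addr0 scaleN1r addNr. Qed.

Lemma lieDl x y z : lie (x + y) z = lie x z + lie y z.
Proof. by have := liePl 1 x y z; rewrite !scale1r. Qed.

Lemma lieDr x y z : lie z (x + y) = lie z x + lie z y.
Proof. by have := liePr 1 x y z; rewrite !scale1r. Qed.

Lemma lieBl x y z : lie (x - y) z = lie x z - lie y z.
Proof. by rewrite -scaleN1r addrC liePl scaleN1r addrC. Qed.

Lemma lieNr x y : lie x (- y) = - lie x y.
Proof. by rewrite -scaleN1r -[_ *: y]addr0 liePr lie0r addr0 scaleN1r. Qed.

Lemma lieC x y : lie y x = - lie x y.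
Proof.
apply/eqP; rewrite -addr_eq0; apply/eqP; have := lie_alternating (x + y).
by rewrite lieDl !lieDr !lie_alternating add0r addr0 addrC.
Qed.

Lemma lie_lie x y z : lie x (lie y z) = lie (lie x y) z - lie (lie x z) y.
Proof.
have := lie_jacobi x y z; rewrite [lie z x]lieC lieNr ![lie _ (lie x _)]lieC opprK.
by move=> /eqP; rewrite -addrA addr_eq0 => /eqP ->; rewrite opprD opprK addrC.
Qed.

Lemma lie_lieC x y z : lie (lie x y) z = lie (lie x z) y + lie x (lie y z).
Proof. by rewrite lie_lie addrC subrK. Qed.

End LieBracket.

(** * Graded families of subspaces and their brackets *)

Section GradedFamilies.
Local Open Scope ring_scope.
Variables (K : fieldType) (L : lieAlgType K) (G : groupType).
Implicit Types (M N S : G -> set L).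

(** The homogeneous components of the span of all brackets; the inductive form carries the degree
    along. *)
Inductive bracket M N : G -> set L :=
| bracket_lie g h x y : M g x -> N h y -> bracket M N (g * h)%g (lie x y)
| bracket0 g : bracket M N g 0
| bracketP c g x y : bracket M N g x -> bracket M N g y ->
    bracket M N g (c *: x + y).

Inductive generated S : G -> set L :=
| generated_in g x : S g x -> generated S g x
| generated_lie g h x y : generated S g x -> generated S h y ->
    generated S (g * h)%g (lie x y)
| generated0 g : generated S g 0
| generatedP c g x y : generated S g x -> generated S g y ->
    generated S g (c *: x + y).

Definition linear_family M : Prop :=
  forall g, M g 0 /\ forall c x y, M g x -> M g y -> M g (c *: x + y).

Definition subalgebra_family M : Prop :=
  linear_family M /\ forall g h x y, M g x -> M h y -> M (g * h)%g (lie x y).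

Definition derived_family n M : G -> set L :=
  iter n (fun M => bracket M M) M.

Lemma bracket_linear M N : linear_family (bracket M N).
Proof. by move=> g; split=> [|c x y]; [exact: bracket0 | exact: bracketP]. Qed.

Lemma bracket_sub M N P : linear_family P ->
  (forall g h x y, M g x -> N h y -> P (g * h)%g (lie x y)) ->
  forall g, bracket M N g `<=` P g.
Proof.
move=> linP MNP g x; elim=> {g x} [g h x y Mx Ny|g|c g x y _ Px _ Py].
- exact: MNP.
- by case: (linP g).
- by case: (linP g) => _; exact.
Qed.

Lemma generated_sub S M : subalgebra_family M -> (forall g, S g `<=` M g) ->
  forall g, generated S g `<=` M g.
Proof.
move=> [linM lieM] SM g x; elim=> {g x} [g x /SM//|g h x y _ Mx _|g|c g x y _ Mx _].
- exact: lieM.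
- by case: (linM g).
- by case: (linM g) => _; exact.
Qed.

Lemma generated_subalgebra S : subalgebra_family (generated S).
Proof.
split=> [g|g h x y]; last exact: generated_lie.
by split=> [|c x y]; [exact: generated0 | exact: generatedP].
Qed.

Lemma bracket_subalgebra M : subalgebra_family M ->
  subalgebra_family (bracket M M).
Proof.
move=> [linM lieM]; split=> [|g h x y Mx My]; first exact: bracket_linear.
have sub := bracket_sub linM lieM.
by apply: bracket_lie; [exact: sub Mx | exact: sub My].
Qed.

Lemma derived_subalgebra n M : subalgebra_family M ->
  subalgebra_family (derived_family n M).
Proof. by move=> sM; elim: n => // n; exact: bracket_subalgebra. Qed.

Lemma derived_sub n M g : subalgebra_family M -> derived_family n M g `<=` M g.
Proof.
move=> [linM lieM]; elim: n g => [|n IHn]; first by move=> g x.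
apply: bracket_sub => // g h x y.
by move=> /IHn Mx /IHn My; exact: lieM.
Qed.

Hypothesis mulC : forall g h : G, (g * h)%g = (h * g)%g.

(** Jacobi writes [[b, [x, y]]] as [[[b, x], y] - [[b, y], x]], so inductively the last factor
    becomes a generator; [mulC] makes the degrees of the two terms agree. *)
Lemma lie_generated M S u a : subalgebra_family M ->
  (forall g, S g `<=` M g) -> generated S u a ->
  forall v b, M v b -> bracket M S (v * u)%g (lie b a).
Proof.
move=> sM SM; have [linM lieM] := sM.
have subM g : generated S g `<=` M g by exact: generated_sub.
elim=> {u a} [g x Sx|g h x y Sx IHx Sy IHy|g|c g x y _ IHx _ IHy] v b Mb.
- exact: bracket_lie.
- rewrite lie_lie -scaleN1r addrC; apply: bracketP.
    rewrite [(g * h)%g]mulC mulgA; apply: IHx; apply: lieM => //; exact: subM.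
  by rewrite mulgA; apply: IHy; apply: lieM => //; exact: subM.
- by rewrite lie0r; exact: bracket0.
- by rewrite liePr; apply: bracketP; [exact: IHx | exact: IHy].
Qed.

End GradedFamilies.

(** * Kreknin's elimination *)

Section Grading.
Local Open Scope ring_scope.
Variables (K : fieldType) (L : lieAlgType K) (G : groupType).
Variables (gr : G -> set L) (X : set G).
Hypothesis mulC : forall g h : G, (g * h)%g = (h * g)%g.
Hypothesis sgr : subalgebra_family gr.
Hypothesis grX : forall g x, gr g x -> x = 0 \/ X g.
Implicit Types (M : G -> set L).

(* Kreknin's elimination: passing from index [2^j - 1] to [2^(j+1) - 1] in the
   derived series removes the components of rank [j] from the generators.  A
   bracket of weight [g], where [rho g = j], can be rewritten so that its last
   factor is a generator of rank at least [j]; by the hypothesis on [rho] both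
   factors then have rank larger than [j]. *)
Lemma kreknin (rho : G -> nat) :
  (forall g h, X g -> X h -> X (g * h)%g ->
    (rho (g * h)%g < rho g /\ rho (g * h)%g < rho h)%N \/
    (rho g < rho (g * h)%g /\ rho h < rho (g * h)%g)%N) ->
  forall j M, subalgebra_family M -> (forall g, M g `<=` gr g) ->
  forall g, derived_family (2 ^ j - 1) M g `<=`
    generated (fun t y => M t y /\ (j <= rho t)%N) g.
Proof.
move=> rho_cyclic; elim=> [|j IHj] M sM Mgr g x.
  by move=> Mx; apply: generated_in.
(* One extra bracket separates two runs of [2 ^ j - 1] derivations; the induction hypothesis is
   applied to both, from [M] to [H] and from [[H, H]] on. *)
have -> : (2 ^ j.+1 - 1 = (2 ^ j - 1) + (2 ^ j - 1).+1)%N.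
  by have := expn_gt0 2 j; rewrite expnS; lia.
rewrite /derived_family iterD iterS -/(derived_family _ M).
set H := derived_family _ M; rewrite -/(derived_family _ (bracket H H)).
have [linM lieM] := sM.
have sH : subalgebra_family H by exact: derived_subalgebra.
have HM t : H t `<=` M t by exact: derived_sub.
have HHM t : bracket H H t `<=` M t.
  by apply: bracket_sub => // *; apply: lieM; exact: HM.
have HHgr t : bracket H H t `<=` gr t by move=> y /HHM/Mgr.
move=> /(IHj _ (bracket_subalgebra sH) HHgr); apply: generated_sub.
  exact: generated_subalgebra.
move=> {x g} g x [HHx]; rewrite leq_eqVlt => /predU1P[gj|jg]; last first.
  by apply: generated_in; split=> //; exact: HHM.
have : bracket M (fun t y => M t y /\ (j <= rho t)%N) g x.
  apply: bracket_sub HHx; first exact: bracket_linear.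
  move=> u v b a Hb Ha; apply: lie_generated (HM _ _ Hb) => //.
    by move=> t y [].
  exact: IHj Ha.
move: gj => /[swap]; elim=> {HHx x g} [g h x y Mx [My jh]|g|c g x y _ IHx _ IHy] gj.
- have [->|Xg] := grX (Mgr _ _ Mx); first by rewrite lie0l; exact: generated0.
  have [->|Xh] := grX (Mgr _ _ My); first by rewrite lie0r; exact: generated0.
  have [->|Xgh] := grX (Mgr _ _ (lieM _ _ _ _ Mx My)); first exact: generated0.
  have [[gg gh]|[_ gh]] := rho_cyclic _ _ Xg Xh Xgh; last by lia.
  by apply: generated_lie; apply: generated_in; rewrite gj.
- exact: generated0.
- by apply: generatedP; [exact: IHx | exact: IHy].
Qed.

(** * Ranks by weight and a central derived term *)

Hypothesis Xfin : finite_set X.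

(** On [X] ranks are at most [|X| - 1], which bounds the number of eliminations independently of
    [N]. *)
Definition theta_rank (theta : G -> nat) (g : G) : nat :=
  #|` [fset h in fset_set X | (theta h < theta g)%N]%fset|.

Lemma theta_rank_lt theta g h : X g -> (theta g < theta h)%N ->
  (theta_rank theta g < theta_rank theta h)%N.
Proof.
move=> Xg gh; apply: fproper_ltn_card; rewrite fproperE.
apply/andP; split; [apply/fsubsetP => k | apply/fsubsetPn; exists g].
- by rewrite !inE => /andP[-> kg]; exact: ltn_trans gh.
- by rewrite !inE /= in_fset_set // gh andbT inE.
- by rewrite !inE ltnn andbF.
Qed.

(** If [h] had larger weight, the set counted by the rank of [g] would miss both [g] and [h]. *)
Lemma theta_rank_max theta g h : X g -> X h ->
  (set_card X - 1 <= theta_rank theta g)%N -> (theta h <= theta g)%N.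
Proof.
move=> Xg Xh kg; rewrite leqNgt; apply/negP => gh.
have hX : h \in fset_set X by rewrite in_fset_set // inE.
have gX : g \in fset_set X by rewrite in_fset_set // inE.
have cardX := cardfsD1 h (fset_set X).
have /fproper_ltn_card : ([fset k in fset_set X | (theta k < theta g)%N] `<`
    fset_set X `\ h)%fset.
  rewrite fproperE.
  apply/andP; split; [apply/fsubsetP => k | apply/fsubsetPn; exists g].
  - rewrite !inE => /andP[-> kg']; rewrite andbT; apply/eqP => kh.
    by move: kg'; rewrite kh ltnNge ltnW.
  - rewrite !inE gX andbT.
    by apply/eqP => gh'; move: gh; rewrite gh' ltnn.
  - by rewrite !inE ltnn andbF.
by move: kg cardX; rewrite /theta_rank /set_card hX; lia.
Qed.

(** Without a carry the sum exceeds both weights; with a carry it lies below both, each weight being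
    less than [N]. *)
Lemma theta_rank_cyclic theta N : cyclic_weight X N theta ->
  forall g h, X g -> X h -> X (g * h)%g ->
    (theta_rank theta (g * h)%g < theta_rank theta g /\
     theta_rank theta (g * h)%g < theta_rank theta h)%N \/
    (theta_rank theta g < theta_rank theta (g * h)%g /\
     theta_rank theta h < theta_rank theta (g * h)%g)%N.
Proof.
move=> [bnd thM] g h Xg Xh Xgh.
have := bnd _ Xg; have := bnd _ Xh; have := bnd _ Xgh.
by have [E|E] := thM _ _ Xg Xh Xgh; [right|left]; split; apply: theta_rank_lt => //; lia.
Qed.

(** Negating the character exchanges carry and no carry. *)
Lemma cyclic_weight_opp theta N : cyclic_weight X N theta ->
  cyclic_weight X N (fun g => N - theta g)%N.
Proof.
move=> [bnd thM]; split=> [g /bnd|g h Xg Xh Xgh]; first by lia.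
have := bnd _ Xg; have := bnd _ Xh; have := bnd _ Xgh.
by have [E|E] := thM _ _ Xg Xh Xgh; [right|left]; lia.
Qed.

(* Weights of brackets of elements of minimal weight never wrap around [N]:
   adding a minimal [theta t] cannot jump past the interval [[0, theta t)]. *)
Lemma generated_min_lie theta N : cyclic_weight X N theta ->
  forall g a, generated
    (fun t y => gr t y /\ forall h, X t -> X h -> (theta t <= theta h)%N) g a ->
  forall z b, gr z b -> (N <= theta z + theta g)%N -> lie b a = 0.
Proof.
move=> [bnd thM]; have [lin_gr lie_gr] := sgr.
set S := fun t y => _.
have Sgr g : generated S g `<=` gr g by apply: generated_sub => // ? ? [].
move=> g a; elim=> {g a}
  [g x [gx ming]|g h x y Sx IHx Sy IHy|g|c g x y _ IHx _ IHy] z b zb Nzg.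
- have [->|Xz] := grX zb; first by rewrite lie0l.
  have [->|Xg] := grX gx; first by rewrite lie0r.
  have [//|Xzg] := grX (lie_gr _ _ _ _ zb gx).
  have := ming _ Xg Xzg; have := bnd _ Xz; have := bnd _ Xzg.
  by have [] := thM _ _ Xz Xg Xzg; lia.
- have [gx hy] := (Sgr _ _ Sx, Sgr _ _ Sy).
  have [->|Xz] := grX zb; first by rewrite lie0l.
  have [->|Xg] := grX gx; first by rewrite lie0l lie0r.
  have [->|Xh] := grX hy; first by rewrite !lie0r.
  have [->|Xgh] := grX (lie_gr _ _ _ _ gx hy); first by rewrite lie0r.
  have [E|E] := thM _ _ Xg Xh Xgh; last by rewrite (IHy g x) ?lie0r //; lia.
  (* Here [theta z + theta g + theta h >= N]. In each Jacobi term either the inner weights already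
     reach [N], or they add without a carry and the outer weights reach [N]. *)
  rewrite lie_lie; have [zg zh] := (lie_gr _ _ _ _ zb gx, lie_gr _ _ _ _ zb hy).
  have -> : lie (lie b x) y = 0.
    have [le|lt] := leqP N (theta z + theta g); first by rewrite (IHx z b) ?lie0l.
    have [->|Xzg] := grX zg; first by rewrite lie0l.
    by apply: IHy zg _; have [] := thM _ _ Xz Xg Xzg; lia.
  have -> : lie (lie b y) x = 0.
    have [le|lt] := leqP N (theta z + theta h); first by rewrite (IHy z b) ?lie0l.
    have [->|Xzh] := grX zh; first by rewrite lie0l.
    by apply: IHx zh _; have [] := thM _ _ Xz Xh Xzh; lia.
  by rewrite subrr.
- by rewrite lie0r.
- by rewrite liePr (IHx z b) // (IHy z b) // scaler0 addr0.
Qed.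

(** Maximal rank for [N - th] means minimal [th], so [generated_min_lie] kills brackets of total
    weight at least [N]. If [theta z + theta g < N], the complementary weights add up to more than
    [N]. *)
Lemma derived_central theta N : cyclic_weight X N theta ->
  forall g a z b, derived_family (2 ^ (set_card X - 1) - 1) gr g a -> gr z b ->
  lie b a = 0.
Proof.
move=> cw; have cw' := cyclic_weight_opp cw.
have half th : cyclic_weight X N th -> cyclic_weight X N (fun g => N - th g)%N ->
    forall g a z b, derived_family (2 ^ (set_card X - 1) - 1) gr g a ->
    gr z b -> (N <= th z + th g)%N -> lie b a = 0.
  move=> cwt [bnd thM] g a z b Da zb; apply: generated_min_lie cwt _ _ _ _ _ zb.
  move: Da => /(kreknin (theta_rank_cyclic (conj bnd thM)) sgr) => /(_ (fun _ _ h => h)).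
  apply: generated_sub; first exact: generated_subalgebra.
  move=> t y [ty rt]; apply: generated_in; split=> // h Xt Xh.
  by have := theta_rank_max Xt Xh rt; have := bnd _ Xt; have := bnd _ Xh; lia.
move=> g a z b Da zb.
have ga : gr g a by exact: derived_sub Da.
have [->|Xg] := grX ga; first by rewrite lie0r.
have [->|Xz] := grX zb; first by rewrite lie0l.
have [le|lt] := leqP N (theta z + theta g)%N; first exact: half cw cw' _ _ _ _ Da zb le.
apply: half cw' _ _ _ _ _ Da zb _.
  split=> [h /cw.1|h k Xh Xk Xhk]; first by lia.
  have := cw.1 _ Xh; have := cw.1 _ Xk; have := cw.1 _ Xhk.
  by have [] := cw.2 _ _ Xh Xk Xhk; lia.
by have := cw.1 _ Xg; have := cw.1 _ Xz; lia.
Qed.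

(** * Iterated brackets with derived terms *)

Lemma subD M g x y : linear_family M -> M g x -> M g y -> M g (x + y).
Proof. by move=> linM Mx My; rewrite -[x]scale1r; apply: (linM g).2. Qed.

(** The left-normed bracket [[x, f i_1, ..., f i_n]]. *)
Definition act (I : Type) (f : I -> L) (x : L) (s : seq I) : L :=
  foldl (fun y i => lie y (f i)) x s.

Lemma actB (I : Type) (f : I -> L) x y s :
  act f (x - y) s = act f x s - act f y s.
Proof. by elim: s x y => //= i s IHs x y; rewrite lieBl IHs. Qed.

Lemma act0 (I : Type) (f : I -> L) s : act f 0 s = 0.
Proof. by elim: s => //= i s IHs; rewrite lie0l. Qed.

Lemma act_eq0 (I : eqType) (f : I -> L) i x s : f i = 0 -> i \in s ->
  act f x s = 0.
Proof.
move=> fi0; elim: s x => //= j s IHs x; rewrite inE => /predU1P[<-|/IHs//].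
by rewrite fi0 lie0r act0.
Qed.

Lemma act_cons (I : Type) (f : I -> L) x i s :
  act f x (i :: s) = act f (lie x (f i)) s.
Proof. by []. Qed.

Lemma act_map (I J : Type) (h : I -> J) (f : J -> L) x s :
  act f x (map h s) = act (f \o h) x s.
Proof. by elim: s x => //= i s IHs x; rewrite IHs. Qed.

(** The components of [[L, L^(i), ..., L^(i)]] with [q] factors [L^(i)]. *)
Definition series i q : G -> set L :=
  iter q (fun P => bracket P (derived_family i gr)) gr.

Lemma series_linear i q : linear_family (series i q).
Proof. by case: q => [|q]; [case: sgr | exact: bracket_linear]. Qed.

Lemma derived_ideal i g h x y : derived_family i gr g x -> gr h y ->
  derived_family i gr (g * h)%g (lie x y).
Proof.
elim: i g h x y => [|i IHi] g h x y; first by case: sgr => _; exact.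
have linD : linear_family (derived_family i.+1 gr) by exact: bracket_linear.
move=> Dx; elim: Dx h y => {g x} [g k x z Dx Dz|g|c g x z _ IHx _ IHz] h y hy.
- rewrite lie_lieC; apply: subD => //.
    rewrite -mulgA [(k * h)%g]mulC mulgA; apply: bracket_lie => //; exact: IHi.
  by rewrite -mulgA; apply: bracket_lie => //; exact: IHi.
- by rewrite lie0l; case: (linD (g * h)%g).
- by rewrite liePl; apply: (linD _).2; [exact: IHx | exact: IHz].
Qed.

Lemma series_ideal i q g h x y : series i q g x -> gr h y ->
  series i q (g * h)%g (lie x y).
Proof.
elim: q g h x y => [|q IHq] g h x y; first by case: sgr => _; exact.
have linS : linear_family (series i q.+1) by exact: bracket_linear.
move=> Dx; elim: Dx h y => {g x} [g k x z Sx Dz|g|c g x z _ IHx _ IHz] h y hy.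
- rewrite lie_lieC; apply: subD => //.
    rewrite -mulgA [(k * h)%g]mulC mulgA; apply: bracket_lie => //; exact: IHq.
  by rewrite -mulgA; apply: bracket_lie => //; exact: derived_ideal.
- by rewrite lie0l; case: (linS (g * h)%g).
- by rewrite liePl; apply: (linS _).2; [exact: IHx | exact: IHz].
Qed.

Lemma series_act (I : Type) (c : I -> G) (f : I -> L) i q s g x :
  (forall j, gr (c j) (f j)) -> series i q g x ->
  series i q (g * \prod_(j <- s) c j)%g (act f x s).
Proof.
move=> cf; elim: s g x => [|j s IHs] g x Sx; first by rewrite big_nil mulg1.
by rewrite big_cons mulgA; apply: IHs; exact: series_ideal.
Qed.

Lemma series_sub_gr i q g : series i q g `<=` gr g.
Proof.
elim: q g => [|q IHq]; first by move=> g x.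
have [lin_gr lie_gr] := sgr; apply: bracket_sub => // g h x y /IHq gx.
by move=> /(derived_sub sgr); exact: lie_gr.
Qed.

Section Permuting.
Variables (I : Type) (c : I -> G) (f : I -> L) (i q : nat).
Hypothesis cf : forall j, derived_family i gr (c j) (f j).

Let cf_gr j : gr (c j) (f j).
Proof. exact: (derived_sub sgr (cf j)). Qed.

Let linS := series_linear i.+1 q.+1.

(** Moving [f j] past [f k] costs a bracket with [[f j, f k]], a new factor from [L^(i+1)]; later
    factors preserve the error because the series consists of ideals. *)
Lemma act_swap s j g x : series i.+1 q g x ->
  series i.+1 q.+1 (g * c j * \prod_(k <- s) c k)%g
    (act f (lie x (f j)) s - lie (act f x s) (f j)).
Proof.
elim: s g x => [|k s IHs] g x Sx.
  by rewrite subrr; case: (linS (g * c j * \prod_(k <- [::]) c k)%g).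
rewrite big_cons !act_cons -[_ - _](subrKA (act f (lie (lie x (f k)) (f j)) s)).
apply: subD => //.
  rewrite -actB lie_lieC addrC addKr mulgA -[(g * _ * _)%g]mulgA.
  by apply: series_act cf_gr _; apply: bracket_lie Sx (bracket_lie (cf j) (cf k)).
rewrite mulgA -[(g * _ * _)%g]mulgA [(c j * _)%g]mulC mulgA.
by apply: IHs; exact: series_ideal.
Qed.

(** Repeated swaps move the factors selected by [a] to the front. *)
Lemma act_filter (a : pred I) s g x : series i.+1 q g x ->
  series i.+1 q.+1 (g * \prod_(k <- s) c k)%g
    (act f x s - act f (act f x (filter a s)) (filter (predC a) s)).
Proof.
elim: s g x => [|k s IHs] g x Sx.
  by rewrite subrr; case: (linS (g * \prod_(k <- [::]) c k)%g).
have Sxk : series i.+1 q (g * c k)%g (lie x (f k)) by exact: series_ideal.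
rewrite big_cons mulgA ![filter _ (k :: s)]/=.
case: (a k); rewrite !act_cons; first exact: IHs.
rewrite -[_ - _](subrKA (act f (act f (lie x (f k)) (filter a s)) (filter (predC a) s))).
apply: subD => //; first exact: IHs.
rewrite -actB.
have -> : (\prod_(k <- s) c k =
    \prod_(k <- filter a s) c k * \prod_(k <- filter (predC a) s) c k)%g.
  elim: s {IHs} => [|l s IHs]; first by rewrite !big_nil mulg1.
  rewrite big_cons /=; case: (a l); rewrite /= big_cons IHs ?mulgA //.
  by congr (_ * _)%g; rewrite mulC.
by rewrite mulgA; apply: series_act => //; exact: act_swap.
Qed.

End Permuting.

(** If all degrees lie in [X], acting first with the factors in an escaping subset [J] leads to a
    degree outside [X], hence to 0; only the error of the reordering remains. *)
Lemma series_act_escape d i q g x (c : 'I_d -> G) (f : 'I_d -> L) :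
  escapes X d -> (forall j, derived_family i gr (c j) (f j)) ->
  series i.+1 q g x ->
  series i.+1 q.+1 (g * \prod_j c j)%g (act f x (index_enum 'I_d)).
Proof.
move=> escX cf Sx; have linS := series_linear i.+1 q.+1.
have cf_gr j : gr (c j) (f j) by exact: (derived_sub sgr (cf j)).
have zero y : y = 0 -> series i.+1 q.+1 (g * \prod_j c j)%g y.
  by move=> ->; case: (linS (g * \prod_j c j)%g).
have [x0|Xg] := grX (series_sub_gr Sx); first by apply: zero; rewrite x0 act0.
have [Xc|] := pselect (forall j, X (c j)); last first.
  move=> /existsNP[j Xcj]; apply: zero.
  by apply: (@act_eq0 _ _ j); [case: (grX (cf_gr j)) | rewrite mem_index_enum].
have [J XJ] := escX g c Xg Xc.
have := act_filter cf (mem J) (index_enum 'I_d) Sx.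
have -> : act f x (filter (mem J) (index_enum 'I_d)) = 0.
  have := series_act (filter (mem J) (index_enum 'I_d)) cf_gr Sx.
  by rewrite big_filter => /series_sub_gr/grX[].
by rewrite act0 subr0.
Qed.

(** Linearity reduces an iterated span to left-normed brackets of homogeneous elements. *)
Lemma iter_bracket_act M P Q m : linear_family Q ->
  (forall g x (s : seq (G * L)), size s = m -> P g x ->
     (forall p, p \in s -> M p.1 p.2) ->
     Q (g * \prod_(p <- s) p.1)%g (act snd x s)) ->
  forall g, iter m (fun P => bracket P M) P g `<=` Q g.
Proof.
elim: m Q => [|m IHm] Q linQ PQ g /=.
  by move=> x Px; have := PQ g x [::] erefl Px; rewrite big_nil mulg1; exact.
apply: bracket_sub => // {}g h x y Px My.
(* [Q'] absorbs the last factor, leaving [m] factors for the induction hypothesis. *)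
pose Q' g z := forall h y, M h y -> Q (g * h)%g (lie z y).
suff : Q' g x by exact.
apply: IHm Px => {g x h y My} [g|g x s sm Px Ms h y My].
  split=> [h y My|c x z Qx Qz h y My]; first by rewrite lie0l; case: (linQ (g * h)%g).
  by rewrite liePl; apply: (linQ _).2; [exact: Qx | exact: Qz].
have := PQ g x (rcons s (h, y)).
rewrite size_rcons sm /act foldl_rcons -cats1 big_cat big_seq1 mulgA; apply=> // p.
by rewrite mem_cat inE => /orP[/Ms//|/eqP ->].
Qed.

Lemma series_mul d i m : escapes X d -> forall g,
  series i (d * m) g `<=` series i.+1 m g.
Proof.
move=> escX; elim: m => [|m IHm] g; first by rewrite muln0.
rewrite mulnS {1}/series iterD -/(series i _).
apply: iter_bracket_act => [|{}g x s sd /IHm Sx Ds]; first exact: series_linear.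
pose t := @Tuple d _ s (introT eqP sd).
have := @series_act_escape d i m g x (fun j => (tnth t j).1) (fun j => (tnth t j).2) escX.
have -> : (\prod_j (tnth t j).1 = \prod_(p <- s) p.1)%g 
  by rewrite -[s in RHS](map_tnth_enum t) big_map [index_enum _]unlock enumT.
have -> : act (fun j => (tnth t j).2) x (index_enum 'I_d) = act snd x s.
  rewrite [index_enum _]unlock -enumT.
  by rewrite -[s in RHS](map_tnth_enum t) act_map.
by apply=> // j; apply: Ds; exact: mem_tnth.
Qed.

Lemma series_expn d i t : escapes X d -> forall g,
  series i (d ^ t) g `<=` series (i + t) 1 g.
Proof.
move=> escX; elim: t i => [|t IHt] i g; first by rewrite expn0 addn0.
rewrite expnS => x /(series_mul escX) /IHt.
by rewrite addSnnS.
Qed.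

Lemma series_eq0 theta N d : cyclic_weight X N theta -> escapes X d ->
  forall g x, series 0 (d ^ (2 ^ (set_card X - 1) - 1)) g x -> x = 0.
Proof.
move=> cw escX g x /(series_expn escX); rewrite add0n /series /=.
elim=> {g x} [g h x y gx Dy|//|c g x y _ -> _ ->]; last by rewrite scaler0 addr0.
exact: derived_central cw _ _ _ _ Dy gx.
Qed.

(** * From homogeneous components to the lower central series *)

Inductive homogeneous_span M : set L :=
| homogeneous_span_in g x : M g x -> homogeneous_span M x
| homogeneous_span0 : homogeneous_span M 0
| homogeneous_spanP c x y : homogeneous_span M x -> homogeneous_span M y ->
    homogeneous_span M (c *: x + y).

Lemma homogeneous_span_subspace M : subspace (homogeneous_span M).
Proof.
split; first by rewrite inE; exact: homogeneous_span0.
by move=> c x y; rewrite !inE; exact: homogeneous_spanP.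
Qed.

(** Index 0 of the derived series is [gr] itself, so [series 0 q] brackets [q] times with all of
    [L]. *)
Lemma lower_central_span q : homogeneous_span gr = setT ->
  lower_central q.+1 `<=` homogeneous_span (series 0 q).
Proof.
move=> spanT; elim: q => [|q IHq]; first by move=> x _; rewrite /series /= spanT.
rewrite /lower_central /= -/(lower_central q.+1) /lie_prod.
apply: smallest_sub; first exact: homogeneous_span_subspace.
move=> _ [x /IHq Sx [y _ <-]]; have : homogeneous_span gr y by rewrite spanT.
elim: Sx => {x} [g x Sx||c x z _ IHx _ IHz] gry.
- elim: gry => {y} [h y gy||c y z _ IHy _ IHz].
  + by apply: homogeneous_span_in; exact: bracket_lie Sx gy.
  + by rewrite lie0r; exact: homogeneous_span0.
  + by rewrite liePr; exact: homogeneous_spanP.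
- by rewrite lie0l; exact: homogeneous_span0.
- by rewrite liePl; apply: homogeneous_spanP; [exact: IHx | exact: IHz].
Qed.

Lemma lower_central0 q : lower_central q (0 : L).
Proof.
case: q => [|[|q]] //=; have [+ _] : subspace (lower_central q.+2 : set L).
  split=> [|c x y]; rewrite !inE.
    by move=> M [subM _]; have [+ _] := subM; rewrite inE.
  by move=> Lx Ly M subM; have [_ +] := subM.1; move=> /(_ c x y); rewrite !inE;
    apply; [exact: Lx | exact: Ly].
by rewrite inE.
Qed.

Lemma lower_central_eq0 theta N d : homogeneous_span gr = setT ->
  cyclic_weight X N theta -> escapes X d ->
  lower_central (d ^ (2 ^ (set_card X - 1) - 1)).+1 = [set 0 : L].
Proof.
move=> spanT cw escX; apply/seteqP; split=> [x|_ ->]; last exact: lower_central0.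
move=> /(lower_central_span spanT); elim=> {x} [g x|//|c x y _ -> _ ->].
  exact: (series_eq0 cw escX).
by rewrite scaler0 addr0.
Qed.

End Grading.

Theorem corollary3p9 (K F : fieldType) (L : lieAlgType K)
    (gr : nonzero F -> set L) (hgr : is_grading gr) :
  let X := grading_support gr in
  arithmetically_free X ->
  nilpotent L /\
  (X !=set0 ->
   nilpotency_class L <= delta X ^ (2 ^ (set_card X - 1) - 1)
                      <= set_card X ^ (2 ^ (set_card X - 1) - 1)).
Proof.
move=> X afX; have [Xfin XP] := afX.
have X1 : ~ X 1%g.
  (* The cyclic subgroup of 1 is trivial, so 1 in [X] would be a period of [X]. *)
  move=> X1; suff : (X `&` periods X) 1%g by rewrite XP.
  split=> //; exists 1%g => // _ [_ [[n _ <-]|[n _ <-]] <-];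
    by rewrite ?expg1n ?invg1 mulg1.
have [N [theta cw]] := cyclic_weight_exists Xfin X1.
have mulC (g h : nonzero F) : (g * h = h * g)%g.
  by apply: val_inj; exact: mulrC.
have lin_gr : linear_family gr.
  move=> g; have [g0 gP] := grading_subspace hgr g; split; first by rewrite inE in g0.
  by move=> c x y gx gy; have := gP c x y; rewrite !inE; exact.
have sgr : subalgebra_family gr by split=> //; exact: grading_lie.
have grX g x : gr g x -> x = 0%R \/ X g.
  move=> gx; have [gr0|] := pselect (gr g = [set 0%R]); last by right.
  by left; move: gx; rewrite gr0.
have spanT : homogeneous_span gr = setT.
  apply/seteqP; split=> // x _; have [s [u [gu ->]]] := grading_span hgr x.
  elim/big_ind: _ => [|y z Sy Sz|g _]; first exact: homogeneous_span0.
    by rewrite -[y]scale1r; exact: homogeneous_spanP.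
  exact: homogeneous_span_in (gu g).
have main d : escapes X d ->
    lower_central (d ^ (2 ^ (set_card X - 1) - 1)).+1 = [set 0%R : L].
  move=> escX; exact: (lower_central_eq0 mulC sgr grX Xfin spanT cw escX).
(* Nilpotency is obtained with [d = |X|], which also covers empty [X]. *)
split; first by eexists; exact: main (escapes_card afX).
move=> X0; have [/andP[d0 dX] escX _] := deltaP afX X0.
apply/andP; split; last first.
  by case: (_ - 1) => // e; rewrite leq_exp2r.
have [|_] := @leastP [set c | lower_central c.+1 = [set 0%R : L]]; last first.
  by apply; exact: main escX.
by eexists; exact: main escX.
Qed.
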